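(* If $H$ is a limit aperiodic group and $\theta:H\to H$ is a group automorphism, then the HNN extension $\star_\theta H$ is a limit aperiodic group.
   Context: If $H=\langle S\mid T\rangle$ is a presentation with generating set $S$ and set of relations $T$, the HNN extension is the group $\star_\theta H=\langle S,t\mid T\cup\{t^{-1}xt=\theta(x): x\in S\}\rangle$, where $t$ is a new generator. For a group $G$ (not necessarily finitely generated) and a finite set $F$ with the discrete topology, $F^G$ denotes the set of all maps $G\to F$ with the product topology, and $G$ acts on $F^G$ by $(g\ast f)(a)=f(g^{-1}a)$. A map $\phi\in F^G$ is aperiodic if $b\ast\phi=\phi$ (with $b\in G$) implies $b=e$. A map $f\in F^G$ is limit aperiodic if every $\phi$ in the closure $\overline{\mathrm{Orb}_G(f)}$ of its $G$-orbit in $F^G$ is aperiodic. A group $G$ is limit aperiodic if there exist a finite set $F$ and a limit aperiodic map $f:G\to F$. *)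

(* Defs.v *)
From HB Require Import structures.
From mathcomp Require Import all_boot all_order all_algebra.
From mathcomp Require Import all_classical all_reals topology.

Set Implicit Arguments.
Unset Strict Implicit.
Unset Printing Implicit Defensive.

Local Open Scope classical_set_scope.
Local Open Scope quotient_scope.
Local Open Scope group_scope.

Section LimitAperiodic.
Variables (G : groupType) (F : finType).

(* [discrete_topology F] is [F] with the discrete topology, and
   [{ptws G -> _}] is the function space with the product topology. *)
Definition config := {ptws G -> discrete_topology F}.

Definition shift (g : G) (f : config) : config := fun a => f (g^-1 * a).

Definition shift_orbit (f : config) : set config :=
  [set shift g f | g in [set: G]].

Definition aperiodic (phi : config) : Prop :=
  forall b : G, shift b phi = phi -> b = 1.

Definition limit_aperiodic (f : config) : Prop :=
  forall phi : config, closure (shift_orbit f) phi -> aperiodic phi.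

End LimitAperiodic.

Definition limit_aperiodic_group (G : groupType) : Prop :=
  exists (F : finType) (f : config G F), limit_aperiodic f.

(* The letter [(x, false)] stands for [x], and [(x, true)] for its inverse. *)
Definition word (S : Type) : Type := seq (S * bool).

HB.instance Definition _ (S : Type) := gen_eqMixin (word S).
HB.instance Definition _ (S : Type) := gen_choiceMixin (word S).

Section Words.
Variable S : Type.

Definition letter (x : S) : word S := [:: (x, false)].

Definition word_inv (w : word S) : word S :=
  rev [seq (a.1, ~~ a.2) | a <- w].

Definition word_eval (G : groupType) (gen : S -> G) (w : word S) : G :=
  \prod_(a <- w) (if a.2 then (gen a.1)^-1 else gen a.1).

(* A relation [u = v] is encoded by the relator [u v^-1], so that a set of
   relations is a set of words. *)
Inductive word_equiv (T : set (word S)) : word S -> word S -> Prop :=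
| word_equiv_refl u : word_equiv T u u
| word_equiv_sym u v : word_equiv T u v -> word_equiv T v u
| word_equiv_trans u v w :
    word_equiv T u v -> word_equiv T v w -> word_equiv T u w
| word_equiv_cancel u x b v :
    word_equiv T (u ++ [:: (x, b); (x, ~~ b)] ++ v) (u ++ v)
| word_equiv_relator u r v : T r -> word_equiv T (u ++ r ++ v) (u ++ v).

End Words.

Section Presented.
Variables (S : Type) (T : set (word S)).

Definition word_eqb (u v : word S) : bool := `[< word_equiv T u v >].

Lemma word_eqb_refl : reflexive word_eqb.
Proof. by move=> u; apply/asboolP; exact: word_equiv_refl. Qed.

Lemma word_eqb_sym : symmetric word_eqb.
Proof.
by move=> u v; apply/idP/idP => /asboolP uv; apply/asboolP;
  exact: word_equiv_sym.
Qed.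

Lemma word_eqb_trans : transitive word_eqb.
Proof.
by move=> v u w /asboolP uv /asboolP vw; apply/asboolP;
  exact: word_equiv_trans uv vw.
Qed.

Canonical word_equiv_rel : equiv_rel (word S) :=
  EquivRel word_eqb word_eqb_refl word_eqb_sym word_eqb_trans.

(* The group <S | T>. *)
Definition presented : Type := {eq_quot word_equiv_rel}.

HB.instance Definition _ := Choice.on presented.

Definition pclass (w : word S) : presented := \pi_{eq_quot word_equiv_rel} w.

Lemma pclassP (u v : word S) : pclass u = pclass v <-> word_equiv T u v.
Proof. by split=> [/eqmodP/asboolP|uv]; [|apply/eqmodP/asboolP]. Qed.

Definition prep (x : presented) : word S :=
  repr (x : {eq_quot word_equiv_rel}).

Lemma prepK x : pclass (prep x) = x.
Proof. exact: reprK. Qed.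

Lemma word_equiv_catl w u v :
  word_equiv T u v -> word_equiv T (w ++ u) (w ++ v).
Proof.
elim=> {u v} [u|u v _ uv|u v z _ uv _ vz|u x b v|u r v Tr].
- exact: word_equiv_refl.
- exact: word_equiv_sym.
- exact: word_equiv_trans uv vz.
- by rewrite !(catA w u); exact: word_equiv_cancel.
- by rewrite !(catA w u); exact: word_equiv_relator.
Qed.

Lemma word_equiv_catr w u v :
  word_equiv T u v -> word_equiv T (u ++ w) (v ++ w).
Proof.
elim=> {u v} [u|u v _ uv|u v z _ uv _ vz|u x b v|u r v Tr].
- exact: word_equiv_refl.
- exact: word_equiv_sym.
- exact: word_equiv_trans uv vz.
- by rewrite -!catA; exact: word_equiv_cancel.
- by rewrite -!catA; exact: word_equiv_relator.
Qed.

Lemma word_equiv_cat u u' v v' : word_equiv T u u' -> word_equiv T v v' ->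
  word_equiv T (u ++ v) (u' ++ v').
Proof.
move=> uu vv; apply: word_equiv_trans (word_equiv_catr v uu) _.
exact: word_equiv_catl.
Qed.

Lemma word_invK : involutive (@word_inv S).
Proof.
move=> w; rewrite /word_inv map_rev revK -map_comp -[RHS]map_id.
by apply: eq_map => -[x b] /=; rewrite negbK.
Qed.

Lemma word_inv_cons a (w : word S) :
  word_inv (a :: w) = word_inv w ++ [:: (a.1, ~~ a.2)].
Proof. by rewrite /word_inv /= rev_cons cats1. Qed.

Lemma word_equiv_mulV w : word_equiv T (w ++ word_inv w) [::].
Proof.
elim: w => [|[x b] w IHw]; first exact: word_equiv_refl.
rewrite word_inv_cons catA.
apply: (@word_equiv_trans _ _ _ ([:: (x, b)] ++ [:: (x, ~~ b)])).
  rewrite -cat1s -catA -[X in word_equiv _ _ X]/([:: (x, b)] ++ [::] ++ _).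
  by rewrite -!catA; apply: word_equiv_catl; rewrite catA;
     exact: word_equiv_catr IHw.
exact: (word_equiv_cancel T [::] x b [::]).
Qed.

Lemma word_equiv_mulVw w : word_equiv T (word_inv w ++ w) [::].
Proof. by rewrite -{2}[w]word_invK; exact: word_equiv_mulV. Qed.

Definition pone : presented := pclass [::].
Definition pmul (x y : presented) : presented := pclass (prep x ++ prep y).
Definition pinv (x : presented) : presented := pclass (word_inv (prep x)).

Lemma pmulE u v : pmul (pclass u) (pclass v) = pclass (u ++ v).
Proof.
by apply/pclassP/word_equiv_cat; apply/pclassP; rewrite prepK.
Qed.

Lemma pmulA : associative pmul.
Proof.
move=> x y z; rewrite -(prepK x) -(prepK y) -(prepK z).
by rewrite !pmulE catA.
Qed.

Lemma pmul1 : left_id pone pmul.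
Proof. by move=> x; rewrite -(prepK x) pmulE. Qed.

Lemma pmulr1 : right_id pone pmul.
Proof. by move=> x; rewrite -(prepK x) pmulE cats0. Qed.

Lemma pmulVx : left_inverse pone pinv pmul.
Proof.
by move=> x; rewrite -{2}(prepK x) pmulE; apply/pclassP/word_equiv_mulVw.
Qed.

Lemma pmulxV : right_inverse pone pinv pmul.
Proof.
by move=> x; rewrite -{1}(prepK x) pmulE; apply/pclassP/word_equiv_mulV.
Qed.

HB.instance Definition _ :=
  isGroup.Build presented pmulA pmul1 pmulr1 pmulVx pmulxV.

Definition pgen (x : S) : presented := pclass (letter x).

End Presented.

(* H = <S | T>, where the generator [x : S] denotes [gen x] in [H]. *)
Definition is_presentation (H : groupType) (S : Type) (gen : S -> H)
    (T : set (word S)) : Prop :=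
  exists phi : {multiplicative presented T -> H},
    bijective phi /\ forall x, phi (pgen T x) = gen x.

Section HNN.
Variables (H : groupType) (S : Type) (gen : S -> H) (T : set (word S)).
Variable theta : H -> H.

(* The generators of the HNN extension are [Some x], for [x : S], and the
   stable letter [None]. *)
Definition hnn_word (w : word S) : word (option S) :=
  [seq (Some a.1, a.2) | a <- w].

(* The right-hand side theta(x) of a relation is an element of H; every word
   [v] in the generators that represents it is allowed. These relators are
   equivalent modulo [T], so this amounts to choosing one such [v] for
   each [x]. *)
Definition hnn_relators : set (word (option S)) :=
  [set hnn_word w | w in T] `|`
  [set r | exists (x : S) (v : word S), word_eval gen v = theta (gen x) /\
     r = word_inv (letter None) ++ letter (Some x) ++ letter None
           ++ word_inv (hnn_word v)].

Definition hnn_extension : groupType := presented hnn_relators.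

End HNN.

(* Every group has a presentation: generators are its elements and relators the
   words that evaluate to 1. *)
Section StandardPresentation.
Variable H : groupType.

Let T : set (word H) := [set w | word_eval id w = 1].

Lemma word_eval_cat (S : Type) (gen : S -> H) u v :
  word_eval gen (u ++ v) = word_eval gen u * word_eval gen v.
Proof. by rewrite /word_eval big_cat. Qed.

Lemma word_eval_inv (S : Type) (gen : S -> H) w :
  word_eval gen (word_inv w) = (word_eval gen w)^-1.
Proof.
elim: w => [|[x b] w IHw]; first by rewrite /word_eval !big_nil invg1.
rewrite word_inv_cons word_eval_cat IHw /word_eval big_seq1 big_cons invgM.
by case: b => //=; rewrite invgK.
Qed.

Lemma word_equiv_eval (S : Type) (gen : S -> H) (R : set (word S)) u v :
  (forall r, R r -> word_eval gen r = 1) ->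
  word_equiv R u v -> word_eval gen u = word_eval gen v.
Proof.
move=> R1; elim=> {u v} [//|u v _ -> //|u v w _ -> _ -> //|u x b v|u r v Rr].
  rewrite !word_eval_cat; congr (_ * _).
  rewrite {1}/word_eval !big_cons big_nil mulg1 /=.
  by case: b; rewrite /= ?mulgV ?mulVg mul1g.
by rewrite !word_eval_cat (R1 r Rr) mul1g.
Qed.

Lemma standard_presentation : is_presentation id T.
Proof.
have T1 r : T r -> word_eval id r = 1 by [].
pose phi (x : presented T) : H := word_eval id (prep x).
have phiE w : phi (pclass T w) = word_eval id w.
  by apply: (word_equiv_eval T1); apply/pclassP; rewrite prepK.
have phiM : {morph phi : x y / x * y}.
  move=> x y; rewrite -(prepK x) -(prepK y) [_ * _ in LHS]pmulE !phiE.
  exact: word_eval_cat.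
pose phi' : {multiplicative presented T -> H} :=
  HB.pack phi (isMultiplicative.Build _ _ phi phiM).
exists phi'; split; last by move=> x; rewrite [LHS]phiE /word_eval big_seq1.
exists (pgen T) => x; last by rewrite [LHS]phiE /word_eval big_seq1.
rewrite -[RHS]prepK; apply/pclassP.
set a := letter _; set w := prep x.
have Tr : T (word_inv w ++ a).
  rewrite /T /= word_eval_cat word_eval_inv {2}/word_eval big_seq1 /=.
  exact: mulVg.
apply: word_equiv_sym.
apply: (@word_equiv_trans _ _ _ (w ++ (word_inv w ++ a) ++ [::])).
  by apply: word_equiv_sym; rewrite -[X in word_equiv _ _ X]cats0;
     exact: word_equiv_relator.
by rewrite cats0 catA; apply: (word_equiv_catr a (word_equiv_mulV T w)).
Qed.

End StandardPresentation.

(* Main.v *)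
(* The HNN extension is the semidirect product of H and Z = <t>, so each element
   is uniquely t^n h. By compactness, f is limit aperiodic iff for each b <> 1
   there is a finite E such that for every g some a in E has
   f (g a) <> f (g b a). If f is such on H and q is such on Z (the parity of the
   2-adic valuation), then t^n h |-> (f h, q n) is such on the extension: when
   b maps to p <> 0 in Z, q separates g a from g b a for some a among finitely
   many powers of t; when b is in H, writing g = t^n h, f separates h a from
   h b a for some a in a finite subset of H that depends only on b. Putting the
   H-component on the right avoids conjugating b by t^n. *)
From HB Require Import structures.
Require Import Defs.
From mathcomp Require Import all_boot all_order all_algebra.
From mathcomp Require Import all_classical all_reals topology.
From mathcomp Require Import zify ring.

Set Implicit Arguments.
Unset Strict Implicit.
Unset Printing Implicit Defensive.

Import GRing.Theory Num.Theory.

Local Open Scope classical_set_scope.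
Local Open Scope group_scope.

(** * Unit and inverses under a multiplicative map *)

Section GroupMorphism.
Variables (G K : groupType) (f : G -> K).
Hypothesis fM : {morph f : x y / x * y}.

Lemma morph_mul1 : f 1 = 1.
Proof. by apply: (mulgI (f 1)); rewrite -fM !mulg1. Qed.

Lemma morph_mulV x : f x^-1 = (f x)^-1.
Proof. by apply: (mulgI (f x)); rewrite -fM !mulgV morph_mul1. Qed.

End GroupMorphism.

(** * Limit aperiodicity as a finitary condition *)

Section FiniteWitness.
Variables (G : groupType) (F : finType).
Implicit Types (f : config G F) (E : seq G).

Definition uniformly_aperiodic f : Prop :=
  forall b : G, b <> 1 ->
    exists E, forall g, exists2 a, a \in E & f (g * a) <> f (g * b * a).

Lemma nbhs_config_eval f (a : G) : nbhs f [set phi : config G F | phi a = f a].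
Proof.
have := @proj_continuous G (fun=> discrete_topology F) a f.
move=> /(_ _ (discrete_set1 _)).
exact.
Qed.

Lemma nbhs_config_agree f E :
  nbhs f [set phi : config G F | forall a, a \in E -> phi a = f a].
Proof.
elim: E => [|a E IHE]; first by apply: filterS filterT => phi _ a.
apply: filterS (filterI (nbhs_config_eval f a) IHE) => phi [/= fa fE] c.
by rewrite in_cons => /predU1P[->|/fE].
Qed.

(** If [b] fixes [phi], take the finite set [E] of [b^-1]. Some translate of [f] agrees with [phi]
    on [E] and [b^-1 E], so it does not separate [a] from [b^-1 a] for any [a] in [E]. *)
Lemma uniformly_aperiodic_limit f :
  uniformly_aperiodic f -> limit_aperiodic f.
Proof.
move=> uf phi clphi b bphi; apply: contrapT => b1.
have b1' : b^-1 <> 1 by move=> /eqP; rewrite invg_eq1 => /eqP.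
have [E fE] := uf _ b1'.
have [_ [[g _ <-] gphi]] :=
  clphi _ (nbhs_config_agree phi (E ++ [seq b^-1 * a | a <- E])).
have [a aE] := fE g^-1; apply.
have := gphi (b^-1 * a); rewrite mem_cat map_f ?orbT // => /(_ isT).
have := gphi a; rewrite mem_cat aE => /(_ isT).
by rewrite /shift mulgA => -> ->; rewrite -{1}bphi.
Qed.

Lemma config_compact : compact [set: config G F].
Proof.
rewrite (_ : setT = [set f : config G F | forall a, setT (f a)]).
  apply: (@tychonoff G (fun=> discrete_topology F) (fun=> setT)) => _.
  exact/finite_compact/(@finite_finset F).
by apply/seteqP; split.
Qed.

(** If no finite set works for [b], the sets [B E] generate a proper filter. By compactness it has a
    cluster point, which lies in the orbit closure and is fixed by [b]. *)
Lemma limit_uniformly_aperiodic f :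
  limit_aperiodic f -> uniformly_aperiodic f.
Proof.
move=> lf b b1; apply: contrapT => nE.
(* The translates of [f] that take equal values at [a] and [b * a] for every [a] in [E]. *)
pose B E : set (config G F) :=
  [set shift g^-1 f |
      g in [set g | forall a, a \in E -> f (g * a) = f (g * b * a)]].
have B0 E : B E !=set0.
  apply: contrapT => BE; apply: nE; exists E => g; apply: contrapT => gE.
  apply: BE; exists (shift g^-1 f), g => //= a aE.
  by apply: contrapT => ne; apply: gE; exists a.
have PF : ProperFilter (filter_from [set: seq G] B).
  apply: filter_from_proper => //; apply: filter_from_filter; first by exists [::].
  move=> E1 E2 _ _; exists (E1 ++ E2) => //.
  by move=> _ [g /= gE <-]; split; exists g => //= a aE; apply: gE;
     rewrite mem_cat aE ?orbT.
have [phi [_ cphi]] := config_compact PF filterT.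
apply: b1; apply: (lf phi).
  move=> U Uphi; have BF : filter_from setT B (B [::]) by exists [::].
  have [_ [[g _ <-] gU]] := cphi _ _ BF Uphi.
  by exists (shift g^-1 f); split=> //; exists g^-1.
apply: funext => a.
(* The test point [b^-1 * a] is moved to [a] by [b], so this member of the filter forces
   [phi (b^-1 * a) = phi a]. *)
have BF : filter_from setT B (B [:: b^-1 * a]) by exists [:: b^-1 * a].
have [_ [[g gE <-] gphi]] := cphi _ _ BF
  (nbhs_config_agree phi [:: a; b^-1 * a]).
have := gE (b^-1 * a) (mem_head _ _).
rewrite -mulgA mulVKg.
have := gphi a; rewrite inE eqxx => /(_ isT).
have := gphi (b^-1 * a); rewrite !inE eqxx orbT => /(_ isT).
by rewrite /shift !invgK => <- <-.
Qed.

End FiniteWitness.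

(** * A limit aperiodic sequence on the integers *)

(* The period-doubling sequence, with the junk value [logn 2 0 = 0] at [0]. *)
Definition valuation_parity (m : int) : bool := odd (logn 2 `|m|).

Lemma logn2_odd (k : nat) (c : int) :
  logn 2 `|((2 ^ k)%N%:Z * (2 * c + 1))%R| = k.
Proof.
rewrite abszM absz_nat lognM ?expn_gt0 //; last by lia.
by rewrite pfactorK // lognE (_ : (2 %| _) = false) ?andbF ?addn0 //; lia.
Qed.

(* If [p] has 2-adic valuation [k], take [m + e] of valuation [k + 1], which
   happens in every window of length [2 ^ (k + 2)]; then [m + p + e] has
   valuation [k]. *)
Lemma valuation_parity_aperiodic (p : int) : p <> 0%R -> exists N : nat,
  forall m : int, exists2 e : nat, (e < N)%N &
    valuation_parity (m + e%:Z)%R <> valuation_parity (m + p + e%:Z)%R.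
Proof.
move=> p0.
have [k [u pE]] : exists k u, p = ((2 ^ k)%N%:Z * (2 * u + 1))%R.
  have [|q q2 pE] := @pfactor_coprime 2 `|p| isT; first by lia.
  rewrite coprime2n in q2; set k := logn _ _ in pE; exists k.
  have [p_ge0|p_lt0] : (0 <= p)%R \/ (p < 0)%R by lia.
    by exists (q./2)%:Z%R; rewrite -[p]gez0_abs // pE PoszM mulrC; congr (_ * _)%R; lia.
  (* For odd [q = 2 j + 1], [- q = 2 (- j - 1) + 1]. *)
  exists (- (q./2)%:Z - 1)%R.
  rewrite -[p]opprK -(ltz0_abs p_lt0) pE PoszM mulrC -mulrN; congr (_ * _)%R; lia.
exists (2 ^ k.+2)%N => m.
(* The offset for which [m + r] is congruent to [2 ^ (k + 1)] modulo [2 ^ (k + 2)]. *)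
pose r := (((2 ^ k.+1)%N%:Z - m) %% (2 ^ k.+2)%N%:Z)%Z.
have r_ge0 : (0 <= r)%R by rewrite modz_ge0 // eqz_nat -lt0n expn_gt0.
exists `|r|%N.
  by rewrite -ltz_nat gez0_abs // ltz_pmod // ltz_nat expn_gt0.
rewrite gez0_abs //.
pose c := (- (((2 ^ k.+1)%N%:Z - m) %/ (2 ^ k.+2)%N%:Z)%Z)%R.
have mrE : (m + r = (2 ^ k.+1)%N%:Z * (2 * c + 1))%R.
  have := divz_eq ((2 ^ k.+1)%N%:Z - m)%R (2 ^ k.+2)%N%:Z%R.
  rewrite -/r -[X in (X * _)%R]opprK -/c => rE.
  have -> : (r = (2 ^ k.+1)%N%:Z - m + c * (2 ^ k.+2)%N%:Z)%R by rewrite rE; ring.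
  by rewrite (expnS 2 k.+1) PoszM; ring.
have mprE : (m + p + r = (2 ^ k)%N%:Z * (2 * (2 * c + 1 + u) + 1))%R.
  by rewrite addrAC mrE pE expnS PoszM; ring.
by rewrite mprE mrE /valuation_parity !logn2_odd /=; case: (odd k).
Qed.

(** * Limit aperiodicity of extensions by the integers *)

(* [rho] reads off the [N]-component of [g] relative to a choice of
   representatives of the cosets [g N]. *)
Lemma limit_aperiodic_group_coset (G N : groupType) (tau : G -> int)
    (rho : G -> N) (incl : N -> G) (sec : nat -> G) :
  (forall g h, tau (g * h) = (tau g + tau h)%R) ->
  (forall n, tau (sec n) = Posz n) ->
  (forall g a, rho (g * incl a) = rho g * a) ->
  (forall g, tau g = 0%R -> exists a, g = incl a) ->
  incl 1 = 1 ->
  limit_aperiodic_group N -> limit_aperiodic_group G.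
Proof.
move=> tauM tausec rhoincl tau0 incl1 [F [f /limit_uniformly_aperiodic uf]].
exists (F * bool)%type.
exists (fun g => (f (rho g), valuation_parity (tau g))).
apply: uniformly_aperiodic_limit => b b1.
have [b0|/valuation_parity_aperiodic[n nP]] := pselect (tau b = 0%R).
  have [c bE] := tau0 _ b0.
  have c1 : c <> 1 by move=> cE; apply: b1; rewrite bE cE.
  have [E fE] := uf _ c1; exists [seq incl a | a <- E] => g.
  (* Right multiplication by [incl c] and [incl a] turns [rho g] into [rho g * c * a], so the finite
     set of [c] serves every [g]. *)
  have [a aE ga] := fE (rho g); exists (incl a); first exact: map_f.
  by rewrite bE !rhoincl => -[].
exists [seq sec e | e <- iota 0 n] => g.
have [e en ge] := nP (tau g); exists (sec e).
  by rewrite map_f // mem_iota.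
by rewrite !tauM tausec => -[].
Qed.

(** * The semidirect product of [H] and the integers *)

Section Semidirect.
Variables (H : groupType) (theta : {multiplicative H -> H}) (theta' : H -> H).
Hypotheses (thetaK : cancel theta theta') (thetaK' : cancel theta' theta).

(** The power [theta^n]; [Negz n] is [-(n + 1)], hence the [n.+1] iterations. *)
Definition iterz (n : int) (h : H) : H :=
  match n with Posz n => iter n theta h | Negz n => iter n.+1 theta' h end.

Lemma iterzS n h : iterz (n + 1)%R h = theta (iterz n h).
Proof.
case: n => n; first by rewrite -PoszD addn1.
case: n => [|n]; first by rewrite /= thetaK'.
by rewrite (_ : (_ + 1)%R = Negz n) /= ?thetaK' //; lia.
Qed.

Lemma iterzB1 n h : iterz (n - 1)%R h = theta' (iterz n h).
Proof. by rewrite -[n in RHS](subrK 1%R) iterzS thetaK. Qed.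

Lemma iterzD m n h : iterz (m + n)%R h = iterz m (iterz n h).
Proof.
elim/int_rect: m => [|m IHm|m IHm]; first by rewrite add0r.
  by rewrite -addn1 PoszD addrAC !iterzS IHm.
by rewrite -addn1 PoszD opprD addrAC !iterzB1 IHm.
Qed.

Lemma iterzM n : {morph iterz n : h k / h * k}.
Proof.
move=> h k; elim/int_rect: n => [//|n IHn|n IHn].
  by rewrite -addn1 PoszD !iterzS IHn gmulfM.
by rewrite -addn1 PoszD opprD !iterzB1 IHn (can2_gmulfM thetaK thetaK').
Qed.

Lemma iterz1 n : iterz n 1 = 1.
Proof. exact/morph_mul1/iterzM. Qed.

(* The pair [(n, h)] stands for [t^n h], where [t^-1 h t = theta h]. *)
Definition semidirect of cancel theta theta' & cancel theta' theta : Type :=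
  (int * H)%type.
Local Notation sd := (semidirect thetaK thetaK').
HB.instance Definition _ := Choice.on sd.

Definition sd_one : sd := (0%R, 1).
(** Moving [h] past [t^n] gives [t^m h t^n k = t^(m + n) theta^n(h) k]. *)
Definition sd_mul (x y : sd) : sd := ((x.1 + y.1)%R, iterz y.1 x.2 * y.2).
Definition sd_inv (x : sd) : sd := ((- x.1)%R, (iterz (- x.1) x.2)^-1).

Lemma sd_mulA : associative sd_mul.
Proof.
move=> x y z; congr pair; first by rewrite addrA.
by rewrite /= mulgA iterzM -iterzD [(z.1 + _)%R]addrC.
Qed.

Lemma sd_mul1 : left_id sd_one sd_mul.
Proof. by case=> n h; rewrite /sd_mul /= add0r iterz1 mul1g. Qed.

Lemma sd_mulr1 : right_id sd_one sd_mul.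
Proof. by case=> n h; rewrite /sd_mul /= addr0 mulg1. Qed.

Lemma sd_mulV : left_inverse sd_one sd_inv sd_mul.
Proof.
case=> n h; rewrite /sd_mul /= addNr; congr pair.
have hE : h = iterz n (iterz (- n)%R h) by rewrite -iterzD subrr.
by rewrite {2}hE -iterzM mulVg iterz1.
Qed.

Lemma sd_mulrV : right_inverse sd_one sd_inv sd_mul.
Proof. by case=> n h; rewrite /sd_mul /= subrr mulgV. Qed.

HB.instance Definition _ :=
  isGroup.Build sd sd_mulA sd_mul1 sd_mulr1 sd_mulV sd_mulrV.

Lemma sd_mulE (x y : sd) :
  x * y = ((x.1 + y.1)%R, iterz y.1 x.2 * y.2) :> sd.
Proof. by []. Qed.

Lemma sd_invE (x : sd) : x^-1 = ((- x.1)%R, (iterz (- x.1) x.2)^-1) :> sd.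
Proof. by []. Qed.

End Semidirect.

(** * Words and their values in presented groups *)

Section Presentations.
Variables (S : Type) (T : set (word S)).

Lemma pclass_cat (u v : word S) : pclass T (u ++ v) = pclass T u * pclass T v.
Proof. exact/esym/pmulE. Qed.

Lemma pclass_inv (w : word S) : pclass T (word_inv w) = (pclass T w)^-1.
Proof.
apply: (mulgI (pclass T w)); rewrite -pclass_cat mulgV.
exact/pclassP/word_equiv_mulV.
Qed.

Lemma pclass_relator r : T r -> pclass T r = 1.
Proof.
move=> Tr; apply/pclassP; rewrite -[r]cats0.
exact: (word_equiv_relator [::]).
Qed.

Lemma pclass_eval w : pclass T w = word_eval (pgen T) w.
Proof.
elim: w => [|[x b] w IHw]; first by rewrite /word_eval big_nil.
rewrite -cat1s pclass_cat IHw /word_eval big_cons; congr (_ * _).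
by case: b => //=; rewrite -pclass_inv.
Qed.

Lemma word_eval_morph (G K : groupType) (f : {multiplicative G -> K})
    (gen : S -> G) w : f (word_eval gen w) = word_eval (f \o gen) w.
Proof.
elim: w => [|[x b] w IHw]; first by rewrite /word_eval !big_nil (morph_mul1 (@gmulfM _ _ f)).
rewrite -cat1s !word_eval_cat gmulfM IHw /word_eval !big_seq1 /=.
by case: b => //=; rewrite (morph_mulV (@gmulfM _ _ f)).
Qed.

(** Restates the isomorphism in terms of words, the form in which the presentation is used below. *)
Lemma presentation_eval (H : groupType) (gen : S -> H) :
  is_presentation gen T ->
  (forall u v, pclass T u = pclass T v <-> word_eval gen u = word_eval gen v) /\
  (forall h, exists w, word_eval gen w = h).
Proof.
case=> phi [[psi phiK psiK] phi_gen].
have phiE w : phi (pclass T w) = word_eval gen w.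
  rewrite pclass_eval word_eval_morph; congr word_eval.
  exact: funext.
split=> [u v|h].
  by rewrite -!phiE; split=> [->//|/(can_inj phiK)].
by exists (prep (psi h)); rewrite -phiE prepK.
Qed.

End Presentations.

(** * Normal form in the HNN extension *)

Section HNNSemidirect.
Variables (H : groupType) (S : Type) (gen : S -> H) (T : set (word S)).
Hypothesis hpres : is_presentation gen T.
Variables (theta : {multiplicative H -> H}) (theta' : H -> H).
Hypotheses (thetaK : cancel theta theta') (thetaK' : cancel theta' theta).

Local Notation G := (hnn_extension gen T theta).
Local Notation R := (hnn_relators gen T theta).
Local Notation sd := (semidirect thetaK thetaK').

Definition hnn_gen (x : option S) : sd :=
  if x is Some y then (0%R, gen y) else (1%R, 1).

Lemma hnn_gen_word w : word_eval hnn_gen (hnn_word w) = (0%R, word_eval gen w).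
Proof.
elim: w => [|[x b] w IHw]; first by rewrite /word_eval !big_nil.
rewrite -cat1s /hnn_word map_cat !word_eval_cat IHw.
rewrite /word_eval !big_seq1 /=.
by case: b; rewrite ?sd_invE sd_mulE /= ?oppr0 addr0.
Qed.

(** Makes [hnn_coords] well defined on classes of words. For the stable letter it amounts to
    [x t = t theta(x)] in the semidirect product. *)
Lemma hnn_gen_relator r : R r -> word_eval hnn_gen r = 1.
Proof.
case=> [[w Tw <-]|[x [v [vE ->]]]].
  rewrite hnn_gen_word; congr pair.
  have /(presentation_eval hpres).1 := pclass_relator Tw.
  by rewrite /word_eval big_nil => ->.
rewrite !word_eval_cat !word_eval_inv hnn_gen_word vE.
have xt : word_eval hnn_gen (letter (Some x)) * word_eval hnn_gen (letter None)
    = word_eval hnn_gen (letter None) * ((0%R, theta (gen x)) : sd).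
  rewrite /word_eval !big_seq1 /=.
  by rewrite !sd_mulE /= mulg1 mul1g add0r addr0.
by rewrite [X in _ * X]mulgA xt mulgK mulVg.
Qed.

Definition hnn_coords (g : G) : sd := word_eval hnn_gen (prep g).

Lemma hnn_coords_pclass w : hnn_coords (pclass R w) = word_eval hnn_gen w.
Proof.
by apply: (word_equiv_eval hnn_gen_relator); apply/pclassP; rewrite prepK.
Qed.

Lemma hnn_coordsM : {morph hnn_coords : g h / g * h}.
Proof.
move=> g h; rewrite -(prepK g) -(prepK h) -pclass_cat !hnn_coords_pclass.
exact: word_eval_cat.
Qed.

(** Relators of [H] are relators of the extension, so a derivation over [T] carries over step by
    step. *)
Lemma pclass_hnn_word u v : word_eval gen u = word_eval gen v ->
  pclass R (hnn_word u) = pclass R (hnn_word v).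
Proof.
move=> /(presentation_eval hpres).1/pclassP uv; apply/pclassP.
elim: uv => {u v} [u|u v _ uv|u v w _ uv _ vw|u x b v|u r v Tr].
- exact: word_equiv_refl.
- exact: word_equiv_sym.
- exact: word_equiv_trans uv vw.
- rewrite /hnn_word !map_cat; exact: word_equiv_cancel.
- rewrite /hnn_word !map_cat; apply: word_equiv_relator.
  by left; exists r.
Qed.

Definition base_word (h : H) : word S :=
  sval (cid ((presentation_eval hpres).2 h)).

Lemma base_wordK h : word_eval gen (base_word h) = h.
Proof. by rewrite /base_word; case: cid. Qed.

Definition base (h : H) : G := pclass R (hnn_word (base_word h)).

Lemma pclass_base w : pclass R (hnn_word w) = base (word_eval gen w).
Proof. by apply: pclass_hnn_word; rewrite base_wordK. Qed.

Lemma base_gen x : base (gen x) = pgen R (Some x).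
Proof.
rewrite -[pgen _ _]/(pclass R (hnn_word (letter x))) pclass_base.
by rewrite /word_eval big_seq1.
Qed.

Lemma baseM : {morph base : h k / h * k}.
Proof.
move=> h k; rewrite -pclass_cat -map_cat pclass_base.
by rewrite word_eval_cat !base_wordK.
Qed.

Lemma base1 : base 1 = 1.
Proof. exact: (morph_mul1 baseM). Qed.

Lemma baseV h : base h^-1 = (base h)^-1.
Proof. exact: (morph_mulV baseM). Qed.

Lemma hnn_coords_base h : hnn_coords (base h) = (0%R, h).
Proof. by rewrite hnn_coords_pclass hnn_gen_word base_wordK. Qed.

Definition stable : G := pgen R None.

Lemma hnn_coords_stable : hnn_coords stable = (1%R, 1).
Proof. by rewrite hnn_coords_pclass /word_eval big_seq1. Qed.

Lemma base_conj_gen x :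
  stable^-1 * base (gen x) * stable = base (theta (gen x)).
Proof.
rewrite base_gen.
have Rr : R (word_inv (letter None) ++ letter (Some x) ++ letter None
    ++ word_inv (hnn_word (base_word (theta (gen x))))).
  by right; exists x, (base_word (theta (gen x))); rewrite base_wordK.
have := pclass_relator Rr; rewrite !pclass_cat !pclass_inv !mulgA.
exact: divg1_eq.
Qed.

(** Both sides are multiplicative in [h], so the relation extends from generators to words. *)
Lemma base_conj h : stable^-1 * base h * stable = base (theta h).
Proof.
rewrite -[h]base_wordK; elim: (base_word h) => [|[x b] w IHw].
  rewrite /word_eval big_nil (morph_mul1 (@gmulfM _ _ theta)) base1.
  by rewrite mulg1 mulVg.
rewrite -cat1s word_eval_cat gmulfM !baseM -IHw !mulgA.
have -> : base (theta (word_eval gen [:: (x, b)])) =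
    stable^-1 * base (word_eval gen [:: (x, b)]) * stable.
  rewrite /word_eval big_seq1 /=; case: b; last by rewrite base_conj_gen.
  rewrite (morph_mulV (@gmulfM _ _ theta)) !baseV -base_conj_gen.
  by rewrite !invgM invgK mulgA.
by rewrite -!mulgA mulVKg.
Qed.

Definition stablez (n : int) : G :=
  match n with Posz n => stable ^+ n | Negz n => stable ^- n.+1 end.

Lemma stablezS n : stablez (n + 1)%R = stablez n * stable.
Proof.
case: n => n; first by rewrite -PoszD addn1 /= expgSr.
case: n => [|n]; first by rewrite /= expg1 mulVg.
rewrite (_ : (_ + 1)%R = Negz n) /=; last by lia.
by rewrite (expgS _ n.+1) invgM mulgVK.
Qed.

Lemma stablezB1 n : stablez (n - 1)%R = stablez n * stable^-1.
Proof. by rewrite -[n in RHS](subrK 1%R) stablezS mulgK. Qed.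

(** Letters are appended on the right; a new [t] passes [h] by [h t = t theta(h)]. *)
Lemma hnn_normal_form g :
  g = stablez (hnn_coords g).1 * base (hnn_coords g).2.
Proof.
rewrite -[g]prepK; elim/last_ind: (prep g) => [|w [x b] IHw].
  by rewrite hnn_coords_pclass /word_eval big_nil /= base1 mulg1.
rewrite -cats1 pclass_cat hnn_coordsM.
move: IHw; set k := pclass R w; case: (hnn_coords k) => n h /= kE.
rewrite [in LHS]kE hnn_coords_pclass pclass_eval /word_eval !big_seq1 /=.
case: x => [x|].
  rewrite -base_gen -mulgA.
  by case: b; rewrite ?sd_invE ?sd_mulE /= ?oppr0 addr0 -?baseV -baseM.
case: b; rewrite ?sd_invE ?sd_mulE /=.
  have -> : theta' 1 = 1 by exact: (iterz1 thetaK thetaK' (-1)%R).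
  rewrite invg1 mulg1 stablezB1 -!mulgA; congr (_ * _).
  (* Writing [h] as [theta (theta' h)] lets [t^-1] pass to the left of it. *)
  rewrite -[h in LHS]thetaK' -base_conj.
  by rewrite -!mulgA mulgV mulg1.
by rewrite mulg1 stablezS -base_conj -!mulgA mulVKg.
Qed.

End HNNSemidirect.

Theorem corollary3p8 (H : groupType) (S : Type) (gen : S -> H)
    (T : set (word S)) (hpres : is_presentation gen T)
    (theta : {multiplicative H -> H}) (htheta : bijective theta)
    (hH : limit_aperiodic_group H) :
  limit_aperiodic_group (hnn_extension gen T theta).
Proof.
case: (htheta) => theta' thetaK thetaK'.
pose coords := @hnn_coords H S gen T theta theta' thetaK thetaK'.
(* For [g = t^n h], [tau] is the exponent [n] and [rho] the factor [h]; the normal form identifies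
   the kernel of [tau] with the image of [H]. *)
apply: (@limit_aperiodic_group_coset _ H (fun g => (coords g).1)
  (fun g => (coords g).2) (base hpres theta)
  (fun n => stable gen T theta ^+ n)) => //.
- by move=> g h; rewrite /coords (hnn_coordsM hpres).
- elim=> [|n IHn].
    by rewrite expg0 /coords (morph_mul1 (hnn_coordsM hpres thetaK thetaK')).
  rewrite expgSr /coords (hnn_coordsM hpres).
  by rewrite (hnn_coords_stable hpres) /= IHn -PoszD addn1.
- by move=> g a; rewrite /coords (hnn_coordsM hpres) (hnn_coords_base hpres).
- move=> g g0; exists (coords g).2.
  by rewrite [LHS](hnn_normal_form hpres thetaK thetaK') -/coords g0 mul1g.
- exact: base1.
Qed.
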